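(* Suppose that $\kappa$ is an uncountable regular cardinal. There is a family of cardinality $2^\kappa$ of compact spaces $K$ of weight $\kappa$ such that the corresponding Banach spaces $C(K)$ are pairwise nonisomorphic.
   Context: All compact spaces are Hausdorff. For a compact space $K$, $C(K)$ is the Banach space of continuous real-valued functions on $K$ with the supremum norm. Banach spaces are isomorphic if there is a bounded linear bijection between them with bounded inverse (not necessarily an isometry). The weight of a space is the least cardinality of a base of its topology. *)

(* Defs.v *)
From HB Require Import structures.
From mathcomp Require Import all_boot all_order all_algebra.
From mathcomp Require Import all_classical all_reals all_analysis.
From mathcomp Require Import wochoice ring.
From mathcomp Require Import wochoice ring.

Set Implicit Arguments.
Unset Strict Implicit.
Unset Printing Implicit Defensive.

Import Order.TTheory GRing.Theory Num.Theory.
Import numFieldNormedType.Exports.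

Local Open Scope classical_set_scope.
Local Open Scope card_scope.
Local Open Scope ring_scope.

(* The cardinal |T| is the least cardinality of a set in the family P. *)
Definition is_least_card (T U : Type) (P : set (set U)) : Prop :=
  (exists2 A, P A & A #= [set: T]) /\ (forall A, P A -> [set: T] #<= A).

(* A cardinal is an initial ordinal: a well-ordered type that is not equipotent
   to any of its proper initial segments. *)
Definition is_cardinal d (T : orderType d) : Prop :=
  well_order (<=%O : rel T) /\
  (forall x : T, ~ ([set: T] #= [set y : T | (y < x)%O])).

Definition cofinal d (T : orderType d) (A : set T) : Prop :=
  forall x : T, exists2 y, A y & (x <= y)%O.

(* A cardinal is regular when it is infinite and equal to its cofinality. *)
Definition is_regular d (T : orderType d) : Prop :=
  infinite_set [set: T] /\ is_least_card T (@cofinal d T).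

Definition has_weight (X : topologicalType) (T : Type) : Prop :=
  is_least_card T (@basis X).

HB.mixin Record Topological_isCompactHausdorff T & Topological T := {
  compactT : compact [set: T];
  hausdorffT : hausdorff_space T
}.

#[short(type="compactSpaceType")]
HB.structure Definition CompactSpace :=
  {T of Topological T & Topological_isCompactHausdorff T}.

Definition cspace (K : compactSpaceType) (R : realType) : Type :=
  continuousType K R.

Section cspace_normed.
Context (K : compactSpaceType) (R : realType).
Implicit Types f g h : cspace K R.

HB.instance Definition _ := Choice.copy (cspace K R) (continuousType K R).

Let ext f g : (forall x : K, f x = g x) -> f = g.
Proof. by move=> fg; apply/continuousEP. Qed.

Let cts0 : continuous (fun _ : K => 0 : R).
Proof. by move=> x; exact: cvg_cst. Qed.

Let ctsD f g : continuous (fun x : K => f x + g x).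
Proof. by move=> x; apply: cvgD; exact: cts_fun. Qed.

Let ctsN f : continuous (fun x : K => - f x).
Proof. by move=> x; apply: cvgN; exact: cts_fun. Qed.

Let ctsZ (a : R) f : continuous (fun x : K => a * f x).
Proof. by move=> x; apply: cvgMr; exact: cts_fun. Qed.

Definition cspace0 : cspace K R := mkcts cts0.
Definition cspaceD f g : cspace K R := mkcts (ctsD (f := f) (g := g)).
Definition cspaceN f : cspace K R := mkcts (ctsN (f := f)).
Definition cspaceZ (a : R) f : cspace K R := mkcts (ctsZ (a := a) (f := f)).

Let addA : associative cspaceD.
Proof. by move=> f g h; apply: ext => x; exact: addrA. Qed.
Let addC : commutative cspaceD.
Proof. by move=> f g; apply: ext => x; exact: addrC. Qed.
Let add0 : left_id cspace0 cspaceD.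
Proof. by move=> f; apply: ext => x; exact: add0r. Qed.
Let addN : left_inverse cspace0 cspaceN cspaceD.
Proof. by move=> f; apply: ext => x; exact: addNr. Qed.

HB.instance Definition _ := GRing.isZmodule.Build (cspace K R)
  addA addC add0 addN.

Let scaleA (a b : R) f : cspaceZ a (cspaceZ b f) = cspaceZ (a * b) f.
Proof. by apply: ext => x; exact: mulrA. Qed.
Let scale1 : left_id 1 cspaceZ.
Proof. by move=> f; apply: ext => x; exact: mul1r. Qed.
Let scaleDr : right_distributive cspaceZ +%R.
Proof. by move=> a f g; apply: ext => x; exact: mulrDr. Qed.
Let scaleDl f : {morph cspaceZ^~ f : a b / a + b}.
Proof. by move=> a b; apply: ext => x; exact: mulrDl. Qed.

HB.instance Definition _ := GRing.Zmodule_isLmodule.Build R (cspace K R)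
  scaleA scale1 scaleDr scaleDl.

(* If K is empty then C(K) = 0, in accordance with sup set0 = 0. *)
Definition sup_norm f : R := sup [set `|f x| | x in [set: K]].

Lemma sup_norm_has_ubound f : has_ubound [set `|f x| | x in [set: K]].
Proof.
have /compact_bounded[M [_ Mf]] : compact [set `|f x| | x in [set: K]].
  apply: continuous_compact; last exact: compactT.
  apply: continuous_subspaceT => x.
  by apply: cvg_norm; exact: cts_fun.
exists (M + 1) => y /(Mf (M + 1)); rewrite ltrDl ltr01 => /(_ isT).
exact/le_trans/ler_norm.
Qed.

Lemma ler_sup_norm f x : `|f x| <= sup_norm f.
Proof. by apply: ub_le_sup; [exact: sup_norm_has_ubound|exists x]. Qed.

Lemma sup_norm_le f (M : R) :
  0 <= M -> (forall x, `|f x| <= M) -> sup_norm f <= M.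
Proof.
rewrite /sup_norm => M0 fM.
have [->|/set0P E0] := eqVneq [set `|f x| | x in [set: K]] set0.
  by rewrite sup0.
by apply: ge_sup => // _ [x _ <-].
Qed.

Let sup_norm_ge0 f : 0 <= sup_norm f.
Proof.
rewrite /sup_norm; have [->|/set0P[_ [x _ _]]] :=
  eqVneq [set `|f x| | x in [set: K]] set0; first by rewrite sup0.
exact: le_trans (normr_ge0 (f x)) (ler_sup_norm f x).
Qed.

Let sup_normD f g : sup_norm (f + g) <= sup_norm f + sup_norm g.
Proof.
apply: sup_norm_le => [|x]; first by rewrite addr_ge0.
by apply: (le_trans (ler_normD _ _)); apply: lerD; exact: ler_sup_norm.
Qed.

Let sup_normZ_le (a : R) f : sup_norm (a *: f) <= `|a| * sup_norm f.
Proof.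
apply: sup_norm_le => [|x]; first by rewrite mulr_ge0.
have -> : `|(a *: f) x| = `|a| * `|f x| by rewrite -normrM.
by rewrite ler_wpM2l// ler_sup_norm.
Qed.

Let sup_normZ (a : R) f : sup_norm (a *: f) = `|a| * sup_norm f.
Proof.
apply/le_anti; rewrite sup_normZ_le/=.
have [->|a0] := eqVneq a 0; first by rewrite normr0 mul0r.
rewrite -[in leLHS](scalerK a0 f).
rewrite -ler_pdivlMl ?normr_gt0// -normfV; exact: sup_normZ_le.
Qed.

Let sup_norm_eq0 f : sup_norm f = 0 -> f = 0.
Proof.
move=> f0; apply: ext => x; apply/normr0_eq0/le_anti.
by rewrite normr_ge0 -f0 ler_sup_norm.
Qed.

HB.instance Definition _ := Lmodule_isNormed.Build R (cspace K R)
  sup_normD sup_normZ sup_norm_eq0.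

Lemma cspace_normE f : `|f| = sup [set `|f x| | x in [set: K]].
Proof. by []. Qed.

End cspace_normed.

Section cspace_complete.
Context (K : compactSpaceType) (R : realType).

Let cspace_complete (F : set_system (cspace K R)) :
  ProperFilter F -> cauchy F -> cvg F.
Proof.
move=> FF Fc.
have Fu (e : R) : 0 < e ->
    exists f : cspace K R, F [set g : cspace K R | forall x, `|f x - g x| <= e].
  move=> e0; have [f Ff] := proj1 (cauchyP _) Fc e e0.
  exists f; apply: filterS Ff => g; rewrite -ball_normE/= => fg x.
  exact: le_trans (ler_sup_norm (f - g) x) (ltW fg).
have Fx (x : K) : cvg ((fun f : cspace K R => f x : R) @ F).
  apply/cauchy_cvgP; apply: cauchy_exP => e e0.
  have [f Ff] := Fu (e / 2) (divr_gt0 e0 (ltr0n _ 2)).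
  exists (f x); suff : F [set g : cspace K R | ball (f x : R) e (g x)] by [].
  apply: filterS Ff => g /= /(_ x) fg.
  by rewrite -ball_normE/=; apply: (le_lt_trans fg);
    rewrite ltr_pdivrMr// ltr_pMr// ltr1n.
pose l (x : K) : R := lim ((fun f : cspace K R => f x : R) @ F).
have Fl (e : R) : 0 < e ->
    F [set g : cspace K R | forall x, `|l x - g x| <= e].
  move=> e0; have [f Ff] := Fu (e / 2) (divr_gt0 e0 (ltr0n _ 2)).
  have fl x : `|f x - l x| <= e / 2.
    have lx : (fun g : cspace K R => `|f x - g x|) @ F --> `|f x - l x|.
      by apply: cvg_norm; apply: cvgB; [exact: cvg_cst|exact: Fx].
    apply: (cvgr_to_le lx).
    suff : F [set g : cspace K R | `|f x - g x| <= e / 2] by [].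
    by apply: filterS Ff => g; exact.
  apply: filterS Ff => g fg x.
  rewrite [e]splitr -(subrKA (f x)).
  apply: (le_trans (ler_normD _ _)); apply: lerD; last exact: fg.
  by rewrite distrC.
have lc : continuous l.
  move=> x; apply/cvgrPdist_le => e e0.
  have e3 : 0 < e / 3 by rewrite divr_gt0.
  have [g lg] := filter_ex (Fl _ e3).
  have /cvgrPdist_le/(_ _ e3) := @cts_fun _ _ g x.
  apply: filterS => y gxy.
  have -> : l x - l y = (l x - g x) + (g x - g y) + (g y - l y) by ring.
  have -> : e = e / 3 + e / 3 + e / 3 by field.
  apply: (le_trans (ler_normD _ _)); apply: lerD.
    by apply: (le_trans (ler_normD _ _)); apply: lerD; [exact: lg|exact: gxy].
  by rewrite distrC; exact: lg.
apply/cvg_ex; exists (mkcts lc : cspace K R).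
apply/cvgrPdist_le => e e0; apply: filterS (Fl _ e0) => g lg.
by apply: sup_norm_le => //; exact: ltW.
Qed.

HB.instance Definition _ :=
  Uniform_isComplete.Build (cspace K R) cspace_complete.

End cspace_complete.

Definition isomorphic (R : realType) (V W : completeNormedModType R) : Prop :=
  exists (f : {linear V -> W}) (g : W -> V),
    [/\ cancel f g, cancel g f, bounded_fun_norm f & bounded_fun_norm g].

(* Main.v *)
From HB Require Import structures.
Require Import Defs.
From mathcomp Require Import all_boot all_order all_algebra.
From mathcomp Require Import all_classical all_reals all_analysis.
From mathcomp Require Import wochoice lra.

Set Implicit Arguments.
Unset Strict Implicit.
Unset Printing Implicit Defensive.

Import Order.TTheory GRing.Theory Num.Theory.
Import numFieldNormedType.Exports.

Local Open Scope classical_set_scope.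
Local Open Scope card_scope.
Local Open Scope ring_scope.

(** To a set S of ordinals below kappa of cofinality omega and a ladder system l
on S one attaches a scattered compact space K_S: besides isolated points of every
level below kappa it has, for each a in S, a point of level a that is the limit of
the ladder of a, made of isolated points of lower level, and a point at infinity
that compactifies the resulting locally compact space. This space has kappa many
isolated points and a base indexed by the finite sequences of points, hence weight
kappa (ladder_weight).

Let seg a consist of the points of level below a and of the point at infinity. The
set seg a is closed when a is not in S (seg_closed), while for a in S the limit
point q of level a adheres to it. Suppose that T is an isomorphism from C(K_S) onto
C(K_S') with inverse G, and that S' minus S is stationary. Every bounded functional
on C(K_S) depends only on the restriction to some seg b
(functional_bounded_support), so by regularity there is a function h such that the
restriction of T f to seg b depends only on that of f to seg (h b), and similarly
for G (operator_support). Pick a in S' minus S closed under both functions, and let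
q be the limit point of level a in K_S'. Since q is a limit of points of lower
level, the functional sending f to T f q depends only on the restriction of f to
seg a; and since seg a is closed in K_S, this functional is uniformly small on the
unit ball of the functions vanishing on seg b, for some b < a (functional_tail). On
the other hand, for every b < a there is u of norm 1 in C(K_S') with u q = 1 such
that G u vanishes on seg b, and T (G u) q = 1: a contradiction
(stationary_diff_not_embed).

Finally Solovay's argument (stationary_split), based on Fodor's lemma, yields kappa
many pairwise disjoint stationary sets of ordinals of cofinality omega. The unions
of subfamilies of these sets form a family indexed by the subsets of kappa, two
different members of which have a stationary difference in at least one direction. *)

(** * Small sets and stationary sets over a regular cardinal *)

Section Regular.
Context (d : Order.disp_t) (kappa : orderType d).

(** A set is small when every function from it to kappa is strictly bounded. For
    an uncountable regular kappa this expresses that its cardinality is less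
    than kappa, but in the form in which regularity is used. *)
Definition small (U : Type) (A : set U) : Prop :=
  forall F : U -> kappa, exists b, forall a, A a -> (F a < b)%O.

Lemma sub_small (U : Type) (A B : set U) : A `<=` B -> small B -> small A.
Proof. by move=> AB sB F; have [b Fb] := sB F; exists b => a /AB/Fb. Qed.

Lemma small_image (U V : Type) (f : U -> V) (A : set U) :
  small A -> small (f @` A).
Proof.
by move=> sA F; have [b Fb] := sA (F \o f); exists b => _ [a Aa <-]; exact: Fb.
Qed.

Context (kappa_card : is_cardinal kappa).
Context (kappa_unc : ~ countable [set: kappa]).
Context (kappa_reg : is_regular kappa).

Let kappa_min (A : set kappa) : A !=set0 ->
  exists2 m, A m & forall x, A x -> (m <= x)%O.
Proof.
move=> [x Ax].
have [|m [[mA minm] _]] := (kappa_card.1 (mem A)).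
  by exists x; rewrite inE.
by exists m => [|y Ay]; [rewrite inE in mA|apply: minm; rewrite inE].
Qed.

Lemma small_card (U : Type) (A : set U) : ~ ([set: kappa] #<= A) -> small A.
Proof.
move=> nA F; apply: contrapT => nb; apply: nA.
apply: card_le_trans (card_image_le F A); apply: (kappa_reg.2.2) => x.
apply: contrapT => nx; apply: nb; exists x => a Aa.
by rewrite ltNge; apply/negP => xa; apply: nx; exists (F a) => //; exists a.
Qed.

Lemma small_seg (x : kappa) : small [set y | (y < x)%O].
Proof.
apply: small_card => le; apply: (kappa_card.2 x).
by rewrite card_eq_le le subset_card_le.
Qed.

Lemma small_countable (U : Type) (A : set U) : countable A -> small A.
Proof.
by move=> cA; apply: small_card => le; apply/kappa_unc/(card_le_trans le cA).
Qed.

Lemma kappa_gt (x : kappa) : exists y, (x < y)%O.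
Proof.
have [|b xb] := @small_countable _ [set x] _ id; first exact: countable1.
by exists b; exact: xb.
Qed.

Lemma small_seg_le (x : kappa) : small [set y | (y <= x)%O].
Proof.
have [y xy] := kappa_gt x.
by apply: sub_small (small_seg y) => z /= zx; exact: le_lt_trans xy.
Qed.

Lemma kappa_point : exists x : kappa, True.
Proof.
apply: contrapT => nx; apply: kappa_unc.
suff -> : [set: kappa] = set0 by exact: countable0.
by apply/seteqP; split=> // x _; apply: nx; exists x.
Qed.

Lemma small_bigcup (I U : Type) (D : set I) (A : I -> set U) :
  small D -> (forall i, D i -> small (A i)) -> small (\bigcup_(i in D) A i).
Proof.
move=> sD sA F; have [x0 _] := kappa_point.
have /choice[b Fb] : forall i, exists b, D i -> forall a, A i a -> (F a < b)%O.
  move=> i; have [Di|nDi] := pselect (D i); last by exists x0.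
  by have [b Fb] := sA i Di F; exists b.
have [c bc] := sD b.
by exists c => a [i Di Aia]; apply: lt_trans (bc i Di); exact: Fb.
Qed.

(** A set filtered along kappa by small levels injects into kappa: well-order it
    compatibly with the levels, so that its proper initial segments are small,
    and map each element strictly above the images of its predecessors. *)
Lemma small_levels_inj (P : choiceType) (lev : P -> kappa) :
  (forall x, small [set p | (lev p <= x)%O]) ->
  exists g : P -> kappa, injective g.
Proof.
move=> slev; have [x0 _] := kappa_point.
have [R Rwo] := well_ordering_principle P.
(* The lexicographic order: first by level, then by an arbitrary well-order. *)
pose lt p q := (lev p < lev q)%O \/ [/\ lev p = lev q, R p q & p <> q].
have lt_wf : well_founded lt.
  move=> p; apply: contrapT => np.
  pose N := [set p | ~ Acc lt p].
  have [|x [q Nq <-] qmin] := kappa_min (A := lev @` N); first by exists (lev p), p.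
  pose N' := [pred r | `[< N r /\ lev r = lev q >]].
  have [|r [[/asboolP[Nr lr] rmin] _]] := Rwo N'; first by exists q; apply/asboolP.
  apply: Nr; constructor => s [ls|[ls Rsr sr]]; apply: contrapT => Ns.
    have : (lev q <= lev s)%O by apply: qmin; exists s.
    by rewrite -lr leNgt ls.
  have Rrs : R r s by apply: rmin; apply/asboolP; split=> //; rewrite ls.
  (* Both r and s are minima of the pair {r, s}, so they are equal. *)
  apply: sr.
  have [|z [_ zu]] := Rwo [pred t | `[< t = r \/ t = s >]].
    by exists r; apply/asboolP; left.
  have R_refl t : R t t.
    have [|w [[/eqP wt wmin] _]] := Rwo [pred u | u == t]; first by exists t; rewrite inE.
    by rewrite -{1}wt; apply: wmin; rewrite inE.
  have <- : z = r.
    by apply: zu; split=> [|t /asboolP[->|->]//]; apply/asboolP; left.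
  by apply/esym/zu; split=> [|t /asboolP[->|->]//]; apply/asboolP; right.
have lt_total p q : p <> q -> lt p q \/ lt q p.
  move=> pq; have [l|l|l] := ltgtP (lev p) (lev q); [by left; left|by right; left|].
  have [|z [[/asboolP zpq zmin] _]] := Rwo [pred t | `[< t = p \/ t = q >]].
    by exists p; apply/asboolP; left.
  case: zpq => zE; [left|right]; right; split=> //; rewrite -?zE.
  - by apply: zmin; apply/asboolP; right.
  - by apply: zmin; apply/asboolP; left.
  - by move=> /esym; rewrite zE.
have step p (rec : forall q, lt q p -> kappa) :
    exists b, forall q (qp : lt q p), (rec q qp < b)%O.
  pose F q := if pselect (lt q p) is left qp then rec q qp else x0.
  have [b Fb] := slev (lev p) F; exists b => q qp.
  have : (F q < b)%O by apply: Fb => /=; case: qp => [/ltW|[->]].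
  by rewrite /F; case: pselect => // qp'; rewrite (Prop_irrelevance qp' qp).
pose g := Fix lt_wf (fun=> kappa) (fun p rec => projT1 (cid (step p rec))).
have gE p : g p = projT1 (cid (step p (fun q _ => g q))).
  rewrite /g Fix_eq// => q f f' ff'; suff -> : f = f' by [].
  by apply: functional_extensionality_dep => r;
     apply: functional_extensionality_dep.
have g_lt p q : lt q p -> (g q < g p)%O.
  by move=> qp; rewrite [g p]gE; case: cid => b /= /(_ q qp).
exists g => p q gpq; apply: contrapT => /lt_total[]/g_lt; by rewrite gpq ltxx.
Qed.

Lemma small_seq (U : eqType) (D : set U) : small D ->
  small [set s : seq U | forall y, y \in s -> D y].
Proof.
move=> sD.
pose L n := [set s : seq U | size s = n /\ forall y, y \in s -> D y].
apply: (@sub_small _ _ (\bigcup_(n in [set: nat]) L n)).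
  by move=> s sP; exists (size s).
apply: small_bigcup => // [|n _]; first exact: small_countable.
elim: n => [|n IHn].
  apply: (@sub_small _ _ [set [::]]) => [s [/size0nil->]//|].
  exact/small_countable/countable1.
apply: (@sub_small _ _ (\bigcup_(y in D) (cons y @` L n))).
  move=> [|y s] [] //= [sn] ysD; exists y; first by apply: ysD; exact: mem_head.
  by exists s => //; split=> // z zs; apply: ysD; rewrite in_cons zs orbT.
by apply: small_bigcup => // y _; exact: small_image.
Qed.

Lemma card_seq_le (U : choiceType) (rk : U -> kappa) :
  (forall x, small [set u | (rk u <= x)%O]) ->
  [set: seq U] #<= [set: kappa].
Proof.
move=> srk; have [x0 _] := kappa_point.
pose lev (s : seq U) := foldr (fun y => Order.max (rk y)) x0 s.
have rk_lev s y : y \in s -> (rk y <= lev s)%O.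
  elim: s => [//|z s IHs]; rewrite in_cons /= le_max => /predU1P[->|/IHs->].
    by rewrite lexx.
  by rewrite orbT.
have [|g g_inj] := small_levels_inj (lev := lev).
  move=> x; apply: sub_small (small_seq (srk x)) => s /= sx y /rk_lev.
  by move=> /le_trans; apply.
have /card_eqPle[_ leg] : [set g s | s in [set: seq U]] #= [set: seq U].
  by apply: inj_card_eq => s t _ _; exact: g_inj.
by apply: card_le_trans leg _; exact: subset_card_le.
Qed.

(** The closed unbounded sets need not be mentioned: the ordinals closed under a
    function h form a club, and every club contains one of this kind up to the
    least element of kappa. A ladder forces its top to be a limit, which makes
    the degenerate least element harmless below. *)
Definition stationary (S : set kappa) : Prop :=
  forall h : kappa -> kappa, exists2 a, S a & forall b, (b < a)%O -> (h b < a)%O.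

Lemma small_bound (m : kappa) (h : kappa -> kappa -> kappa) :
  exists x, forall b c, (b <= m)%O -> (c <= m)%O -> (h c b < x)%O.
Proof.
have : small (\bigcup_(c in [set c | (c <= m)%O])
                (h c @` [set b | (b <= m)%O])).
  apply: small_bigcup => [|c _]; first exact: small_seg_le.
  exact/small_image/small_seg_le.
move=> /(_ id)[x xP]; exists x => b c bm cm.
by apply: xP; exists c => //; exists b.
Qed.

(** Pressing-down lemma. *)
Lemma fodor (S : set kappa) (f : kappa -> kappa) :
  stationary S -> (forall a, S a -> (f a < a)%O) ->
  exists c, stationary [set a | S a /\ f a = c].
Proof.
move=> statS freg; apply: contrapT => /forallNP nst.
have /choice[h hP] : forall c, exists h : kappa -> kappa,
    forall a, S a -> f a = c -> exists2 b, (b < a)%O & (a <= h b)%O.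
  move=> c; have /existsNP[h hn] := nst c; exists h => a Sa fa.
  apply: contrapT => nb; apply: hn; exists a => // b ba.
  by rewrite ltNge; apply/negP => ahb; apply: nb; exists b.
have /choice[H HP] := small_bound ^~ h.
(* Closure under H is closure under the diagonal intersection of the h c. *)
have [a Sa aH] := statS H.
have [b ba ahb] := hP (f a) a Sa erefl.
have /aH Hma : (Order.max (f a) b < a)%O by rewrite gt_max freg.
have := HP (Order.max (f a) b) b (f a).
rewrite !le_max !lexx orbT => /(_ isT isT) /lt_trans/(_ Hma).
by rewrite ltNge ahb.
Qed.

(** A strictly increasing cofinal sequence of length omega in the initial
    segment below a. *)
Definition ladder (a : kappa) (l : nat -> kappa) : Prop :=
  [/\ forall k, (l k < l k.+1)%O, forall k, (l k < a)%O &
      forall b, (b < a)%O -> exists k, (b <= l k)%O].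

Lemma stationary_ladder : stationary [set a | exists l, ladder a l].
Proof.
move=> h; have [x0 _] := kappa_point.
have /choice[H HP] : forall x, exists y, (x < y)%O /\
    forall b, (b <= x)%O -> (h b < y)%O.
  move=> x; have [y yP] := small_bound x (fun c b => h b).
  have [z xz] := kappa_gt x; exists (Order.max z y); split=> [|b bx].
    by rewrite lt_max xz.
  by rewrite lt_max (yP b x)// orbT.
pose l k := iter k H x0.
have [a aP amin] : exists2 a, (forall k, l k < a)%O &
    forall x, (forall k, l k < x)%O -> (a <= x)%O.
  apply: kappa_min; have [b bP] := @small_countable _ [set: nat] (countableP _) l.
  by exists b => k; exact: bP.
have lad : ladder a l.
  split=> // [k|b ba]; first by rewrite /l iterS; exact: (HP _).1.
  apply: contrapT => /forallNP nb; suff : (a <= b)%O by rewrite leNgt ba.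
  by apply: amin => k; rewrite ltNge; apply/negP.
exists a; first by exists l.
have [_ _ lcof] := lad; move=> b /lcof[k bk].
by apply: le_lt_trans (aP k.+1); rewrite /l iterS ltW// (HP _).2.
Qed.

(** Solovay's splitting for cofinality omega: some rung a |-> l a n of the ladders
    has kappa many stationary fibres, indexed here by an injection e. *)
Lemma stationary_split (E : set kappa) (l : kappa -> nat -> kappa) :
  stationary E -> (forall a, E a -> ladder a (l a)) ->
  exists n (e : kappa -> kappa), injective e /\
    forall c, stationary [set a | E a /\ l a n = e c].
Proof.
move=> statE lE.
(* If no rung were stationarily often above every x, then for all n the values
   l a n would be bounded by a fixed x_n on a club, hence all the ladders would
   be bounded by one y < kappa on a club. *)
have [n nP] : exists n, forall x,
    stationary [set a | E a /\ (x <= l a n)%O].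
  apply: contrapT => /forallNP nst.
  have /choice[xh xhP] : forall n, exists xh : kappa * (kappa -> kappa),
      forall a, E a -> (xh.1 <= l a n)%O ->
      exists2 b, (b < a)%O & (a <= xh.2 b)%O.
    move=> n; have /existsNP[x /existsNP[h hn]] := nst n; exists (x, h) => a Ea xa.
    apply: contrapT => nb; apply: hn; exists a => // b ba.
    by rewrite ltNge; apply/negP => ahb; apply: nb; exists b.
  have sN := @small_countable _ [set: nat] (countableP _).
  have [y yP] := sN (fun n => (xh n).1).
  have /choice[H HP] : forall b, exists x, (y < x)%O /\ forall n, ((xh n).2 b < x)%O.
    move=> b; have [x xP] := sN (fun n => (xh n).2 b).
    have [z yz] := kappa_gt y.
    exists (Order.max z x); split=> [|n]; first by rewrite lt_max yz.
    by rewrite lt_max xP// orbT.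
  have [a Ea aH] := statE H; have [_ la lcof] := lE a Ea.
  have ya : (y < a)%O by apply: lt_trans (HP (l a 0)).1 (aH _ (la 0)).
  have [n yn] := lcof y ya.
  have [b ba] := xhP n a Ea (ltW (lt_le_trans (yP n I) yn)).
  by apply/negP; rewrite -ltNge; apply: lt_trans ((HP b).2 n) (aH b ba).
pose Z := [set c | stationary [set a | E a /\ l a n = c]].
have Zcof : cofinal Z.
  move=> x; have [|c cP] := @fodor _ (l ^~ n) (nP x).
    by move=> a [/lE[_ la _] _]; exact: la.
  exists c; last by have [a [[_ +] <-]] := cP id.
  by move=> h; have [a [[Ea _] ac] ah] := cP h; exists a.
have /card_leP[e] := kappa_reg.2.2 Z Zcof.
have eT c : c \in [set: kappa] by rewrite inE.
exists n, (fun c => val (e (SigSub (eT c)))); split.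
  move=> c c' /val_inj/inj; rewrite !inE => /(_ I I).
  by move=> /(congr1 val).
move=> c; case: (e _) => z /= /set_mem; exact.
Qed.

End Regular.

(** * The compact space of a ladder system *)

Section LadderSpace.
Context (d : Order.disp_t) (kappa : orderType d).
Context (S : set kappa) (l : kappa -> nat -> kappa).
Context (lS : forall a, S a -> ladder a (l a)).

(** The underlying set consists of the points (a, c), for a in kappa and c a
    boolean, and of a point at infinity None. The point (a, true) with a in S is
    the limit of the points (l a k, false); all the other points (a, c) are
    isolated. The proof argument is carried by the type so that the canonical
    instances below can use it. *)
Definition ladder_space of (forall a, S a -> ladder a (l a)) : Type :=
  option (kappa * bool).

Local Notation T := (ladder_space lS).

HB.instance Definition _ := Choice.on T.

(** The largest basic neighbourhood of a point; those of the points other than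
    None turn out to be compact and open. *)
Definition ladder_nb (y : T) : set T :=
  if y is Some (a, c)
  then [set x | x = y \/ [/\ c, S a & exists k, x = Some (l a k, false)]]
  else [set: T].

(** A neighbourhood of a limit point contains a tail of its ladder; the complement
    of a neighbourhood of None is covered by finitely many ladder_nb (Some y). *)
Definition ladder_open (U : set T) : Prop :=
  (forall a, S a -> U (Some (a, true)) ->
     exists m, forall k, (m <= k)%N -> U (Some (l a k, false))) /\
  (U None -> exists s : seq (kappa * bool), forall x, ~ U x ->
     exists2 y, y \in s & ladder_nb (Some y) x).

Let ladder_openT : ladder_open setT.
Proof. by split=> [a _ _|_]; [exists 0|exists [::] => x; case]. Qed.

Let ladder_openI : setI_closed ladder_open.
Proof.
move=> A B [A1 A2] [B1 B2]; split=> [a Sa [Aa Ba]|[AN BN]].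
  have [m mA] := A1 a Sa Aa; have [n nB] := B1 a Sa Ba.
  by exists (maxn m n) => k; rewrite geq_max => /andP[mk nk]; split; auto.
have [s sA] := A2 AN; have [t tB] := B2 BN.
exists (s ++ t) => x /not_andP[/sA|/tB][y ys yx]; exists y => //.
  by rewrite mem_cat ys.
by rewrite mem_cat ys orbT.
Qed.

Let ladder_open_bigU (I : Type) (f : I -> set T) :
  (forall i, ladder_open (f i)) -> ladder_open (\bigcup_i f i).
Proof.
move=> fop; split=> [a Sa [i _ fa]|[i _ fN]].
  by have [m mf] := (fop i).1 a Sa fa; exists m => k /mf; exists i.
have [s sP] := (fop i).2 fN.
by exists s => x nx; apply: sP => fx; apply: nx; exists i.
Qed.

HB.instance Definition _ :=
  isOpenTopological.Build T ladder_openT ladder_openI ladder_open_bigU.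

Lemma ladder_openE (U : set T) : open U = ladder_open U.
Proof. by []. Qed.

Lemma ladder_mono a (i j : nat) : S a -> (i <= j)%N -> (l a i <= l a j)%O.
Proof.
move=> /lS[lt_l _ _] /subnK <-; elim: (j - i)%N => [//|n IHn].
by rewrite addSn; apply: le_trans IHn (ltW (lt_l _)).
Qed.

Lemma ladder_eventually a b : S a -> (b < a)%O ->
  exists m, forall k, (m <= k)%N -> (b < l a k)%O.
Proof.
move=> Sa ba; have [lt_l _ lcof] := lS Sa; have [m bm] := lcof b ba.
exists m.+1 => k mk; apply: lt_le_trans (ladder_mono Sa mk).
exact: le_lt_trans bm (lt_l m).
Qed.

Lemma ladder_nbxx (y : T) : ladder_nb y y.
Proof. by case: y => [[a c]|]//; left. Qed.

(** Two ladders with different tops meet in a finite set. *)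
Lemma ladder_almost_disjoint a b c : S a -> a <> b ->
  exists m, forall k, (m <= k)%N -> ~ ladder_nb (Some (b, c)) (Some (l a k, false)).
Proof.
move=> Sa ab; have [lt_l la _] := lS Sa.
have [abl|bal|//] := ltgtP a b; last first.
  have [m mP] := ladder_eventually Sa bal; exists m => k /mP bk.
  case=> [[lb _]|[_ Sb [j []]]]; first by rewrite lb ltxx in bk.
  have [_ lb _] := lS Sb => lab; have := lt_trans bk.
  by rewrite lab => /(_ _ (lb j)); rewrite ltxx.
have [Sb|nSb] := pselect (S b); last first.
  exists 0 => k _ [[lb _]|[_ Sb _]]//.
  by have := lt_trans (la k) abl; rewrite lb ltxx.
have [m mP] := ladder_eventually Sb abl.
have [n nP] : exists n, forall j, (j < m)%N -> forall k, (n <= k)%N ->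
    l a k <> l b j.
  elim: m {mP} => [|m [n nP]]; first by exists 0.
  have [[i ilm]|nim] := pselect (exists i, l a i = l b m); last first.
    exists n => j; rewrite ltnS leq_eqVlt => /predU1P[->|/nP//] k _ kbm.
    by apply: nim; exists k.
  exists (maxn n i.+1) => j + k; rewrite geq_max => + /andP[nk ik].
  rewrite ltnS leq_eqVlt => /predU1P[->|/nP]; last exact.
  rewrite -ilm => ki; have := lt_le_trans (lt_l i) (ladder_mono Sa ik).
  by rewrite ki ltxx.
exists n => k nk [[lb _]|[_ _ [j []]]].
  by have := lt_trans (la k) abl; rewrite lb ltxx.
have [jm|mj] := ltnP j m; first exact: nP.
by move=> lab; have := lt_trans (mP j mj); rewrite -lab => /(_ _ (la k)); rewrite ltxx.
Qed.

Lemma ladder_nb_sub_open (y : kappa * bool) (A : set T) :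
  A `<=` ladder_nb (Some y) ->
  (y.2 -> S y.1 -> exists m, forall k, (m <= k)%N -> A (Some (l y.1 k, false))) ->
  open A.
Proof.
case: y => b c /= Ay yA; rewrite ladder_openE; split=> [a Sa /[dup] Aa /Ay|/Ay].
  by case=> [[ab cT]|[_ _ [k []]]//]; rewrite ab; apply: yA; rewrite -?cT -?ab.
by case=> [//|[_ _ [k]]].
Qed.

Lemma ladder_nb_sub_closed (y : kappa * bool) (A : set T) :
  A `<=` ladder_nb (Some y) -> A (Some y) -> closed A.
Proof.
move=> Ay yA; rewrite -[A]setCK; apply: open_closedC; rewrite ladder_openE.
split=> [a Sa na|_].
  have [m mP] : exists m, forall k, (m <= k)%N ->
      ~ ladder_nb (Some (y.1, y.2)) (Some (l a k, false)).
    have [ay|ay] := pselect (a = y.1); last exact: ladder_almost_disjoint.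
    have yF : y.2 = false.
      by apply/negP => yT; apply: na; rewrite ay -yT; case: (y) yA.
    exists 0 => k _; rewrite yF => -[[la]|[]//].
    by have [_ /(_ k)] := lS Sa; rewrite la ay ltxx.
  exists m => k mk Ak; apply: (mP k mk).
  by have := Ay _ Ak; case: (y).
exists [:: y] => x /contrapT/Ay xy; exists y => //; exact: mem_head.
Qed.

Lemma ladder_nb_open (y : T) : open (ladder_nb y).
Proof.
case: y => [[a c]|]; last exact: openT.
apply: (@ladder_nb_sub_open (a, c)) => //= cT Sa; exists 0 => k _.
by right; split=> //; exists k.
Qed.

Lemma ladder_nb_closed (y : T) : closed (ladder_nb y).
Proof.
case: y => [y|]; last exact: closedT.
by apply: (@ladder_nb_sub_closed y) => //; exact: ladder_nbxx.
Qed.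

(** The isolated points among those other than None. *)
Definition isolated (x : T) :=
  exists y : kappa * bool, x = Some y /\ ~ (y.2 /\ S y.1).

Lemma open_isolated x : isolated x -> open [set x].
Proof.
move=> [[a c] [-> /= nac]]; apply: (@ladder_nb_sub_open (a, c)) => /=.
  by move=> z ->; left.
by move=> cT Sa; case: nac.
Qed.

Lemma isolated_false a : isolated (Some (a, false)).
Proof. by exists (a, false); split=> // -[]. Qed.

Lemma nb_minus_open (y : kappa * bool) (U : set T) :
  open U -> U (Some y) ->
  exists s : seq T, (forall z, z \in s -> isolated z /\ z <> Some y) /\
    ladder_nb (Some y) `\` [set` s] `<=` U.
Proof.
move=> Oop Oy; have [[yT Sy]|ny] := pselect (y.2 /\ S y.1); last first.
  exists [::]; split=> // x [xy _]; case: y Oy ny xy => a c /= Oy ny [->//|[cT Sa _]].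
  by case: ny.
case: y Oy yT Sy => a [|//] /= Oa _ Sa.
rewrite ladder_openE in Oop; have [m mO] := Oop.1 a Sa Oa.
exists [seq Some (l a k, false) | k <- iota 0 m]; split.
  by move=> z /mapP[k _ ->]; split=> //; exact: isolated_false.
move=> x [[->//|[_ _ [k ->]]] nk].
have [km|mk] := ltnP k m; last exact: mO.
case: nk => /=; apply/mapP; exists k => //.
by rewrite mem_iota.
Qed.

Let ultra_seq (I : eqType) (F : set_system T) (s : seq I) (A : I -> set T) :
  UltraFilter F -> F [set x | exists2 i, i \in s & A i x] ->
  exists2 i, i \in s & F (A i).
Proof.
move=> FU; elim: s => [|i s IHs] Fs.
  have [] := filter_not_empty F; apply: filterS Fs.
  by move=> x [].
have [Fi|Fi] := in_ultra_setVsetC (A i) FU; first by exists i => //; exact: mem_head.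
have [|j js Fj] := IHs; last by exists j => //; rewrite in_cons js orbT.
apply: filterS (filterI Fs Fi) => x [[j + Ajx] nix].
by rewrite in_cons => /predU1P[ji|js]; [case: nix; rewrite -ji|exists j].
Qed.

Let cvg_open (F : set_system T) (p : T) : UltraFilter F ->
  ~ (F --> p) -> exists U, [/\ open U, U p & F (~` U)].
Proof.
move=> FU nFp; apply: contrapT => nO; apply: nFp => A.
rewrite nbhsE => -[U [Oop Op] OA].
have [FO|FO] := in_ultra_setVsetC U FU; first exact: filterS FO.
by case: nO; exists U.
Qed.

Lemma ladder_compact : compact [set: T].
Proof.
rewrite compact_ultra => F FU _.
suff [p Fp] : exists p : T, F --> p by exists p.
apply: contrapT => /forallNP nF.
have [U [Oop ON FO]] := cvg_open FU (nF None); move: Oop.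
rewrite ladder_openE => -[_ /(_ ON)[s sO]].
have [y ys Fy] := @ultra_seq _ F s (fun y => ladder_nb (Some y)) FU
  (filterS sO FO).
have [U' [U'op U'y FO']] := cvg_open FU (nF (Some y)).
have [t [tiso tO]] := nb_minus_open U'op U'y.
have [z zt Fz] : exists2 z, z \in t & F [set z].
  apply: ultra_seq; apply: filterS (filterI Fy FO') => x [yx nx].
  by exists x => //; apply: contrapT => nxt; apply: nx; exact: tO.
have [U'' [U''op U''z FO'']] := cvg_open FU (nF z).
have [] := filter_not_empty F.
by apply: filterS (filterI Fz FO'') => x [->].
Qed.

Lemma ladder_hausdorff : hausdorff_space T.
Proof.
rewrite open_hausdorff => x y /eqP xy.
wlog [z zx zy] : x y xy / exists2 z : T, ladder_nb z x & ~ ladder_nb z y.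
  move=> wl.
  have [/(wl x y xy)//|nz] :=
    pselect (exists2 z : T, ladder_nb z x & ~ ladder_nb z y).
  have [|[A B]/= [Ay Bx] [Aop Bop AB]] := wl y x (nesym xy); last first.
    by exists (B, A); split=> //=; rewrite setIC.
  have xyz z : ladder_nb z x -> ladder_nb z y.
    by move=> zx; apply: contrapT => zy; apply: nz; exists z.
  have := xyz _ (ladder_nbxx x).
  case: x {wl nz xyz} xy => [[a c]|] xy.
    move=> [yx|[_ Sa [k yk]]]; first by case: xy.
    exists y; first exact: ladder_nbxx.
    rewrite yk => -[ax|[]//]; case: ax => al _.
    by have [_ /(_ k)] := lS Sa; rewrite -al ltxx.
  move=> _; exists y; first exact: ladder_nbxx.
  by case: y xy => [[a c]|]// _ [//|[_ _ [k]]].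
exists (ladder_nb z, ~` ladder_nb z) => /=; first by rewrite !inE.
split.
- exact: ladder_nb_open.
- by apply: closed_openC; exact: ladder_nb_closed.
- by rewrite setICr eqxx.
Qed.

HB.instance Definition _ :=
  Topological_isCompactHausdorff.Build T ladder_compact ladder_hausdorff.

End LadderSpace.

(** * Weight and initial segments of the ladder space *)

Section Weight.
Context (d : Order.disp_t) (kappa : orderType d).
Context (kappa_card : is_cardinal kappa).
Context (kappa_unc : ~ countable [set: kappa]).
Context (kappa_reg : is_regular kappa).
Context (S : set kappa) (l : kappa -> nat -> kappa).
Context (lS : forall a, S a -> ladder a (l a)).

Local Notation T := (ladder_space lS).

(** The points of level less than b, together with the point at infinity. *)
Definition seg (b : kappa) : set T :=
  [set x : T | if x is Some (a, _) then (a < b)%O else True].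

Lemma small_points (A : set kappa) :
  small kappa A -> small kappa [set x : T | if x is Some (a, _) then A a else True].
Proof.
move=> sA; have sb (U : countType) (B : set U) : small kappa B.
  exact/small_countable.
have sa : small kappa (\bigcup_(c in [set: bool]) ((fun a => Some (a, c) : T) @` A)).
  by apply: small_bigcup => // c _; exact: small_image.
apply: (@sub_small _ _ _ _ (\bigcup_(c in [set: bool])
    if c then [set None : T] else
    \bigcup_(c in [set: bool]) ((fun a => Some (a, c) : T) @` A))).
  move=> [[a c]|] /= Aa; last by exists true.
  by exists false => //; exists c => //; exists a.
apply: small_bigcup => // -[] _ //.
exact/small_countable/countable1.
Qed.

Lemma small_seg_space b : small kappa (seg b).
Proof. exact/small_points/small_seg. Qed.

(* A base indexed by the finite sequences of points: the first term, None by
   default, selects a basic neighbourhood, from which those of the remaining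
   terms are removed. *)
Let base (s : seq T) : set T :=
  ladder_nb (head (None : T) s) `\` \bigcup_(z in [set` behead s]) ladder_nb z.

Let basis_base : basis (range base).
Proof.
split=> [_ [s _ <-]|x A].
  rewrite /base setDE; apply: openI; first exact: ladder_nb_open.
  apply: closed_openC.
  by apply: closed_bigcup => [|z _]; [exact: finite_seq|exact: ladder_nb_closed].
rewrite nbhsE => -[U [Uop Ux] UA].
suff [s sx sU] : exists2 s, base s x & base s `<=` U.
  exists (base s); last exact: subset_trans UA.
  by split=> //; exists s.
case: x Ux => [y|] Ux.
  have [s [siso sU]] := nb_minus_open Uop Ux; exists (Some y :: s).
    split; first exact: ladder_nbxx.
    move=> [z /= zs]; have [[w [zE nw]] zy] := siso z zs; rewrite zE.
    case: w zE nw => a c zE nac [yz|[cT Sa _]]; last exact: nac.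
    by apply: zy; rewrite yz.
  move=> x [xy xs]; apply: sU; split=> //= xs'; apply: xs.
  by exists x => //; exact: ladder_nbxx.
have := Uop; rewrite ladder_openE => -[_ /(_ Ux)[s sP]].
exists (None :: map Some s); rewrite /base /=.
  by split=> // -[z /= /mapP[[a c] _ ->]] [//|[_ _ [k]]].
move=> x [_ nx]; apply: contrapT => /sP[y ys xy]; apply: nx.
by exists (Some y) => //=; apply: map_f.
Qed.

Lemma ladder_weight : has_weight T kappa.
Proof.
have ge (A : set (set T)) : basis A -> [set: kappa] #<= A.
  move=> [_ bA].
  pose f (a : kappa) : set T := [set Some (a, false)].
  have /card_eqPle[_ le] : [set f a | a in [set: kappa]] #= [set: kappa].
    apply: inj_card_eq => a b _ _ /seteqP[/(_ (Some (a, false)) erefl) + _].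
    by move=> /= [].
  apply: card_le_trans le _; apply: subset_card_le => _ [a _ <-].
  have /bA[U [AU Ua] Ux] : nbhs (Some (a, false) : T) (f a).
    by apply: open_nbhs_nbhs; split=> //; exact/open_isolated/isolated_false.
  suff <- : U = f a by [].
  by apply/seteqP; split=> // x ->.
split=> //; exists (range base) => //.
rewrite card_eq_le ge// andbT; apply: card_le_trans (card_image_le _ _) _.
have [x0 _] := kappa_point kappa_unc.
apply: (card_seq_le kappa_card kappa_unc kappa_reg
  (rk := fun x : T => if x is Some (a, _) then a else x0)) => b.
apply: sub_small (small_points (small_seg_le kappa_card kappa_unc kappa_reg b)).
by move=> [[a c]|].
Qed.

Lemma seg_mono b c : (b <= c)%O -> seg b `<=` seg c.
Proof. by move=> bc [[a e]|//] /= ab; exact: lt_le_trans bc. Qed.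

Lemma seg_open b : open (seg b `\ None).
Proof.
rewrite ladder_openE; split=> [a Sa [/= ab _]|[_ []]//].
by exists 0 => k _; split=> //=; have [_ la _] := lS Sa; exact: lt_trans ab.
Qed.

(** The only point outside seg b that can adhere to it is (b, true), and it does so
    exactly when b belongs to S: this is how the topology records S. *)
Lemma seg_closed b : ~ S b -> closed (seg b).
Proof.
move=> nSb; rewrite -[seg b]setCK; apply: open_closedC; rewrite ladder_openE.
split=> [a Sa /= /negP|[]//]; rewrite -leNgt le_eqVlt => /predU1P[ab|ba].
  by case: nSb; rewrite ab.
have [m mP] := ladder_eventually lS Sa ba.
by exists m => k /mP bk /=; apply/negP; rewrite -leNgt ltW.
Qed.

(** A neighbourhood of the limit point (a, true) that avoids seg b. *)
Definition nb_tail (a b : kappa) : set T :=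
  ladder_nb (Some (a, true) : T) `\` seg b.

Lemma nb_tail_open a b : (b < a)%O -> open (nb_tail a b).
Proof.
move=> ba; apply: (@ladder_nb_sub_open _ _ _ _ lS (a, true)).
  by move=> x [].
move=> _ /= Sa; have [m mP] := ladder_eventually lS Sa ba.
exists m => k /mP bk; split=> /=; first by right; split=> //; exists k.
by apply/negP; rewrite -leNgt ltW.
Qed.

Lemma nb_tail_closed a b : (b < a)%O -> closed (nb_tail a b).
Proof.
move=> ba; apply: (@ladder_nb_sub_closed _ _ _ _ lS (a, true)).
  by move=> x [].
by split; [exact: ladder_nbxx|apply/negP; rewrite -leNgt ltW].
Qed.

End Weight.

Arguments seg {d kappa S l} lS b.
Arguments nb_tail {d kappa S l} lS a b.

(** * Continuous functions and functionals on a filtered compact space *)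

Section Functions.
Context (R : realType) (K : compactSpaceType).

Lemma indic_continuous (W : set K) : open W -> closed W ->
  continuous (fun x : K => (x \in W)%:R : R).
Proof.
move=> Wop Wcl x; have [Wx|nWx] := pselect (W x); apply: cvg_near_cst.
  have : nbhs x W by exact: open_nbhs_nbhs.
  by apply: filterS => y Wy; rewrite !mem_set.
have : nbhs x (~` W) by apply: open_nbhs_nbhs; split=> //; exact: closed_openC.
by apply: filterS => y Wy; rewrite !memNset.
Qed.

(** Restriction to P and extension by zero preserve continuity when P has no boundary
    point other than o and the function vanishes at o. *)
Lemma cut_continuous (o : K) (P : set K) (h : K -> R) :
  open (P `\ o) -> closed P -> continuous h -> h o = 0 ->
  continuous (fun x => if x \in P then h x else 0).
Proof.
move=> Pop Pcl hc ho x; have [nPx|Px] := pselect (~ P x).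
  apply: cvg_near_cst.
  have : nbhs x (~` P) by apply: open_nbhs_nbhs; split=> //; exact: closed_openC.
  by apply: filterS => y Wy; rewrite !memNset.
move/contrapT: Px => Px; rewrite /continuous_at /= (mem_set Px); have [xo|xo] := eqVneq x o.
  apply/cvgrPdist_lt => e e0; have /cvgrPdist_lt/(_ _ e0) := hc x.
  apply: filterS => y; rewrite xo ho; case: ifPn => // _ _.
  by rewrite subrr normr0.
apply: cvg_trans (hc x); apply: near_eq_cvg.
have : nbhs x (P `\ o) by apply: open_nbhs_nbhs; split=> //; split=> //; exact/eqP.
by apply: filterS => y [Py _]; rewrite mem_set.
Qed.

(** Soft thresholding: the map t - (|t + e| - |t - e|) / 2 moves t towards 0 by e,
    and is 0 on [-e, e]. *)
Lemma shrink_continuous (e : R) (h : K -> R) : continuous h ->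
  continuous (fun x => h x - (`|h x + e| - `|h x - e|) / 2).
Proof.
move=> hc x; apply: cvgB; first exact: hc.
apply: cvgMl; apply: cvgB; apply: cvg_norm.
  by apply: cvgD; [exact: hc|exact: cvg_cst].
by apply: cvgB; [exact: hc|exact: cvg_cst].
Qed.

Lemma shrinkP (e t : R) : 0 <= e -> let s := t - (`|t + e| - `|t - e|) / 2 in
  [/\ `|s| <= `|t|, `|t - s| <= e & `|t| <= e -> s = 0].
Proof.
move=> e0 s; rewrite /s {s}.
have [te|te] := lerP 0 (t + e); have [te'|te'] := lerP 0 (t - e);
  rewrite ?(ger0_norm te) ?(ltr0_norm te) ?(ger0_norm te') ?(ltr0_norm te').
- split.
  + by rewrite !ger0_norm; lra.
  + by rewrite ger0_norm; lra.
  + by rewrite ger0_norm; lra.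
- have -> : t - (t + e - - (t - e)) / 2 = 0 by lra.
  by split; rewrite ?normr0 ?normr_ge0// subr0 ler_norml; lra.
- lra.
- split.
  + by rewrite !ler0_norm; lra.
  + by rewrite ler0_norm; lra.
  + by rewrite ler0_norm; lra.
Qed.

(** phi is a linear functional bounded by M on C(K). *)
Definition bounded_functional (M : R) (phi : cspace K R -> R) : Prop :=
  [/\ forall f g, phi (f + g) = phi f + phi g,
      forall a f, phi (a *: f) = a * phi f &
      forall f, `|phi f| <= M * `|f| ].

(** The closed set P is exhausted, apart from its point o, by the increasing open
    sets Q b minus o, for b in D. *)
Section Tail.
Context (d : Order.disp_t) (I : orderType d) (D : set I).
Context (o : K) (P : set K) (Q : I -> set K).
Context (D0 : D !=set0) (Pop : open (P `\ o)) (Pcl : closed P).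
Context (Qop : forall b, open (Q b `\ o)) (Qo : forall b, Q b o).
Context (Qmono : forall b c, (b <= c)%O -> Q b `<=` Q c).
Context (PQ : P `\ o `<=` \bigcup_(b in D) Q b).

Lemma cover_tail (C : set K) : closed C -> C `<=` P `\ o -> forall b, D b ->
  exists2 b', D b' /\ (b <= b')%O & C `<=` Q b'.
Proof.
move=> Ccl CP b0 Db0.
have /compact_near_coveringP Ccov : compact C.
  exact: subclosed_compact Ccl (@compactT K) (@subsetT _ _).
pose F := filter_from D (fun b => [set b' | D b' /\ (b <= b')%O]).
have FF : ProperFilter F.
  apply: filter_from_proper; last by move=> b Db; exists b; split=> //=.
  apply: filter_from_filter => // b c Db Dc.
  exists (Order.max b c) => /=; first by rewrite /Order.max; case: ifP.
  by move=> x [Dx]; rewrite ge_max => /andP[bx cx]; split.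
have [|b Db bP] := Ccov _ F (fun b x => Q b x) _.
  move=> x /CP[Px xo]; have [|b Db Qbx] := PQ (t := x); first by [].
  exists (Q b `\ o, [set b' | D b' /\ (b <= b')%O]) => /=; last first.
    by move=> [y c] /= [[Qby _] [_ bc]]; exact: Qmono Qby.
  split; first by apply: open_nbhs_nbhs.
  by exists b.
exists (Order.max b b0).
  by rewrite le_max lexx orbT; split=> //; rewrite /Order.max; case: ifP.
apply: bP; split; rewrite ?le_max ?lexx//.
by rewrite /Order.max; case: ifP.
Qed.

(** If phi depends only on the restriction to P, then phi is uniformly small on
    the unit ball of the functions vanishing on Q b, for b in D large enough.
    Otherwise there are, far out in D, successive functions of norm at most 1
    with disjoint supports on which phi exceeds e / 2; their sums still have norm
    at most 1, and phi is unbounded on them. *)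
Lemma functional_tail (M : R) (phi : cspace K R -> R) :
  bounded_functional M phi ->
  (forall f : cspace K R, (forall x, P x -> f x = 0) -> phi f = 0) ->
  forall e : R, 0 < e -> exists2 b, D b & forall f : cspace K R,
    `|f| <= 1 -> (forall x, Q b x -> f x = 0) -> `|phi f| <= e.
Proof.
move=> [phiD phiZ phiM] phiP e e0; apply: contrapT => ntail.
(* The bound M may be replaced by its maximum with 0. *)
have M0 : 0 <= Num.max M 0 by rewrite le_max lexx orbT.
have {}phiM f : `|phi f| <= Num.max M 0 * `|f|.
  by apply: le_trans (phiM f) _; rewrite ler_wpM2r// le_max lexx.
move: (Num.max M 0) M0 phiM => {}M M0 phiM.
have phiN f : phi (- f) = - phi f by rewrite -scaleN1r phiZ mulN1r.
have large b : D b -> exists f : cspace K R,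
    [/\ `|f| <= 1, forall x, Q b x -> f x = 0 & e < phi f].
  move=> Db; apply: contrapT => nf; apply: ntail; exists b => // f f1 fQ.
  rewrite ler_norml lerNl -phiN; apply/andP; split; rewrite leNgt; apply/negP => pf.
    apply: nf; exists (- f); split=> //; first by rewrite normrN.
    by move=> x /fQ fx; rewrite -[RHS]oppr0 -fx.
  by apply: nf; exists f.
have bump b : D b -> exists (g : cspace K R) b',
    [/\ D b' /\ (b <= b')%O, forall x, `|g x| <= 1, forall x, Q b x -> g x = 0,
        forall x, ~ Q b' x -> g x = 0 & e / 2 <= phi g].
  move=> Db; have [f [fle1 fQ ef]] := large b Db.
  have fo : f o = 0 by exact: fQ.
  (* Cut f to P, which phi does not notice, and then threshold it, so that its
     support is contained in some Q b'. *)
  have f1c := cut_continuous Pop Pcl (@cts_fun _ _ f) fo.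
  pose f1 : cspace K R := mkcts f1c.
  have f1E x : f1 x = if x \in P then f x else 0 by [].
  pose e1 : R := e / (2 * (M + 1)).
  have M1 : 0 < M + 1 by rewrite ltr_wpDl.
  have e10 : 0 < e1 by rewrite divr_gt0// mulr_gt0.
  pose g : cspace K R := mkcts (shrink_continuous (e := e1) f1c).
  have gP x : [/\ `|g x| <= `|f1 x|, `|f1 x - g x| <= e1 &
      `|f1 x| <= e1 -> g x = 0] by exact: shrinkP (ltW e10).
  have [b' [Db' bb'] Cb'] : exists2 b', D b' /\ (b <= b')%O &
      [set x | e1 <= `|f1 x|] `<=` Q b'.
    apply: cover_tail => //.
      suff -> : [set x | e1 <= `|f1 x|] = (fun x => `|f1 x|) @^-1` [set y | e1 <= y].
        apply: closed_comp => [x _|]; last exact: closed_ge.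
        by apply: cvg_norm; exact: f1c.
      by [].
    move=> x; have [xP|xP] := boolP (x \in P); last first.
      by rewrite /= f1E (negbTE xP) normr0 leNgt e10.
    move=> ex; split; first exact: set_mem.
    by move=> xo; move: ex; rewrite /= f1E xo fo if_same normr0 leNgt e10.
  exists g, b'; split=> //.
  - move=> x; have [gx _ _] := gP x; apply: le_trans gx _.
    rewrite f1E; case: ifP => _; last by rewrite normr0.
    exact: le_trans (ler_sup_norm f x) fle1.
  - move=> x Qx; have [_ _] := gP x; apply.
    by rewrite f1E (fQ _ Qx) if_same normr0 ltW.
  - move=> x nQ; have [_ _] := gP x; apply.
    by rewrite leNgt; apply/negP => /ltW /Cb'.
  have phif1 : phi f = phi f1.
    apply/eqP; rewrite -subr_eq0 -phiN -phiD; apply/eqP/phiP => x Px.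
    have -> : (f - f1) x = f x - f1 x by [].
    by rewrite f1E mem_set// subrr.
  have f1g : phi f1 - phi g <= e / 2.
    rewrite -phiN -phiD; apply: le_trans (ler_norm _) _.
    apply: le_trans (phiM _) _.
    have le1 : `|f1 - g| <= e1.
      by apply: sup_norm_le (ltW e10) _ => x; have [] := gP x.
    apply: (@le_trans _ _ (M * e1)); first exact: ler_wpM2l.
    have ee1 : e = e1 * (2 * (M + 1)).
      by rewrite /e1 divfK// mulf_neq0// ?gt_eqF.
    by rewrite [in leRHS]ee1; nra.
  by move: ef f1g; rewrite phif1; lra.
have [b0 Db0] := D0.
have many n : exists (g : cspace K R) b',
    [/\ D b', forall x, `|g x| <= 1, 
        forall x, ~ Q b' x -> g x = 0 & (e / 2) *+ n <= phi g].
  elim: n => [|n [g [b [Db g1 gQ en]]]].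
    exists 0, b0; split=> //.
    + by move=> x; rewrite (_ : (0 : cspace K R) x = 0)// normr0.
    + by rewrite mulr0n -(scale0r (0 : cspace K R)) phiZ mul0r.
  have [g' [b' [[Db' bb'] g'1 g'Q g'Q' eg']]] := bump b Db.
  exists (g + g'), b'; split=> //.
  - move=> x; have -> : (g + g') x = g x + g' x by [].
    have [Qx|nQx] := pselect (Q b x); first by rewrite g'Q// addr0.
    by rewrite gQ// add0r.
  - move=> x nQx; have -> : (g + g') x = g x + g' x by [].
    by rewrite g'Q'// addr0 gQ// => Qbx; apply: nQx; exact: Qmono Qbx.
  by rewrite phiD mulrS addrC lerD.
have [n nP] : exists n, M < (e / 2) *+ n.
  have := archi_boundP (divr_ge0 M0 (ltW (divr_gt0 e0 (ltr0n _ 2)))).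
  set n := Num.bound _ => nP; exists n.
  by rewrite -mulr_natl -ltr_pdivrMr// divr_gt0.
have [g [b [_ g1 _ eg]]] := many n.
have : phi g <= M.
  apply: le_trans (ler_norm _) _; apply: le_trans (phiM _) _.
  by rewrite ler_piMr//; apply: sup_norm_le.
by rewrite leNgt (lt_le_trans nP eg).
Qed.

End Tail.
End Functions.

(** * Operators between spaces of continuous functions *)

Section Operators.
Context (d : Order.disp_t) (kappa : orderType d) (R : realType).
Context (kappa_card : is_cardinal kappa).
Context (kappa_unc : ~ countable [set: kappa]).
Context (kappa_reg : is_regular kappa).
Context (l : kappa -> nat -> kappa).

Lemma bounded_fun_norm_le (V W : normedModType R) (f : {linear V -> W}) :
  bounded_fun_norm f -> exists M : R, forall x, `|f x| <= M * `|x|.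
Proof.
move=> /(_ 1)[M fM]; exists M => x; have [->|x0] := eqVneq x 0.
  by rewrite linear0 !normr0 mulr0.
have nx : 0 < `|x| by rewrite normr_gt0.
rewrite -ler_pdivrMr// mulrC.
have := fM (`|x|^-1 *: x); rewrite linearZ !normrZ normfV normr_id.
by apply; rewrite mulVf// gt_eqF.
Qed.

(** A bounded functional on C(K) is determined by the restriction to some seg b. *)
Lemma functional_bounded_support (S : set kappa)
    (lS : forall a, S a -> ladder a (l a)) (M : R)
    (phi : cspace (ladder_space lS) R -> R) :
  bounded_functional M phi ->
  exists b, forall f : cspace (ladder_space lS) R,
    (forall x, seg lS b x -> f x = 0) -> phi f = 0.
Proof.
move=> phib; have [x0 _] := kappa_point kappa_unc.
have tail := @functional_tail R (ladder_space lS) _ kappa setT None setT (seg lS).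
have /choice[b bP] : forall n : nat, exists b, forall f : cspace (ladder_space lS) R,
    `|f| <= 1 -> (forall x, seg lS b x -> f x = 0) -> `|phi f| <= n.+1%:R^-1.
  move=> n; suff [b _ bP] : exists2 b, setT b &
      forall f : cspace (ladder_space lS) R,
      `|f| <= 1 -> (forall x, seg lS b x -> f x = 0) -> `|phi f| <= n.+1%:R^-1.
    by exists b.
  apply: (tail _ _ _ _ _ _ _ M) => //.
  - by exists x0.
  - rewrite setTD; apply: closed_openC.
    exact/accessible_closed_set1/hausdorff_accessible/ladder_hausdorff.
  - exact: seg_open.
  - exact: seg_mono.
  - move=> [[a c]|] [_ /= aN]; last by case: aN.
    by have [b ab] := kappa_gt kappa_unc kappa_reg a; exists b.
  - move=> f f0; have -> : f = 0 by apply/continuousEP => x; exact: f0.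
    by case: phib => _ phiZ _; rewrite -(scale0r (0 : cspace _ R)) phiZ mul0r.
have [c bc] := small_countable kappa_unc kappa_reg (countableP [set: nat]) b.
exists c => f f0; have [_ phiZ _] := phib.
suff f1 (g : cspace (ladder_space lS) R) : `|g| <= 1 ->
    (forall x, seg lS c x -> g x = 0) -> phi g = 0.
  have nf : 0 < `|f| + 1 by rewrite ltr_wpDl.
  have : phi ((`|f| + 1)^-1 *: f) = 0.
    apply: f1 => [|x /f0 fx].
      by rewrite normrZ gtr0_norm ?invr_gt0// ler_pdivrMl// mulr1 lerDl.
    by rewrite -[RHS](mulr0 (`|f| + 1)^-1) -fx.
  rewrite phiZ => /eqP; rewrite mulf_eq0 invr_eq0 (gt_eqF nf).
  by rewrite orFb => /eqP.
move=> g1 g0; apply/normr0_eq0/le_anti; rewrite normr_ge0 andbT.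
apply/ler_addgt0Pr => e e0; rewrite add0r.
have [n ne] : exists n : nat, n.+1%:R^-1 <= e.
  exists (Num.bound e^-1); rewrite -[leRHS]invrK lef_pV2 ?posrE ?invr_gt0//.
  apply: le_trans (ltW (archi_boundP _)) _; first by rewrite invr_ge0 ltW.
  by rewrite ler_nat.
apply: le_trans ne; apply: bP => // x bx; apply: g0.
by apply: seg_mono bx; exact/ltW/bc.
Qed.

(** The restriction of T f to seg b is determined by that of f to seg (h b). *)
Lemma operator_support (S S' : set kappa)
    (lS : forall a, S a -> ladder a (l a)) (lS' : forall a, S' a -> ladder a (l a))
    (T : {linear cspace (ladder_space lS) R -> cspace (ladder_space lS') R}) :
  bounded_fun_norm T ->
  exists h : kappa -> kappa, forall b (f : cspace (ladder_space lS) R),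
    (forall x, seg lS (h b) x -> f x = 0) -> forall y, seg lS' b y -> T f y = 0.
Proof.
move=> /bounded_fun_norm_le[M TM].
suff /choice[h hP] : forall b, exists c,
    forall f : cspace (ladder_space lS) R, (forall x, seg lS c x -> f x = 0) -> forall y, seg lS' b y -> T f y = 0.
  by exists h.
move=> b.
have /choice[c cP] : forall y : ladder_space lS', exists c,
    forall f : cspace (ladder_space lS) R,
    (forall x, seg lS c x -> f x = 0) -> T f y = 0.
  move=> y; apply: (@functional_bounded_support _ _ M (fun f => T f y)).
  split=> [f g|a f|f].
  - by rewrite linearD.
  - by rewrite linearZ.
  - by apply: le_trans (TM f); exact: ler_sup_norm.
have [e eP] := small_seg_space kappa_card kappa_unc kappa_reg (lS := lS') b c.
exists e => f fe y yb; apply: (cP y) => x xc; apply: fe.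
by apply: seg_mono xc; exact/ltW/eP.
Qed.

(** The heart of the argument: the isomorphism type of C(K) determines S up to a
    nonstationary set. Only a bounded right inverse G of T is needed. *)
Lemma stationary_diff_not_embed (S S' : set kappa)
    (lS : forall a, S a -> ladder a (l a)) (lS' : forall a, S' a -> ladder a (l a))
    (T : {linear cspace (ladder_space lS) R -> cspace (ladder_space lS') R})
    (G : {linear cspace (ladder_space lS') R -> cspace (ladder_space lS) R}) :
  stationary (S' `\` S) -> cancel G T ->
  bounded_fun_norm T -> bounded_fun_norm G -> False.
Proof.
move=> statD GK Tb Gb.
have [hT hTP] := operator_support Tb; have [hG hGP] := operator_support Gb.
have [M TM] := bounded_fun_norm_le Tb; have [N GN] := bounded_fun_norm_le Gb.
have [a [S'a nSa] ha] := statD (fun b => Order.max (hT b) (hG b)).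
have [lt_l la lcof] := lS' _ S'a.
pose q : ladder_space lS' := Some (a, true).
have phib : bounded_functional M (fun f => T f q).
  split=> [f g|c f|f].
  - by rewrite linearD.
  - by rewrite linearZ.
  - by apply: le_trans (TM f); exact: ler_sup_norm.
(* Evaluation of T f at q depends only on the restriction of f to seg a: if f
   vanishes there, then T f vanishes on the ladder converging to q. *)
have phi0 (f : cspace (ladder_space lS) R) :
    (forall x, seg lS a x -> f x = 0) -> T f q = 0.
  move=> f0.
  have Tf0 y : seg lS' a y -> y <> None -> T f y = 0.
    case: y => [[b c]|]// /= ba _; have [k bk] := lcof b ba.
    apply: (hTP (l a k.+1)) => [x xs|/=]; last exact: le_lt_trans (lt_l k).
    apply: f0; apply: seg_mono xs; apply/ltW.
    by have := ha _ (la k.+1); rewrite gt_max => /andP[].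
  apply/eqP; apply: contrapT => /negP Tq.
  have : nbhs q [set y | T f y != 0].
    suff nT : nbhs (T f q) [set t : R | t != 0] by exact: (@cts_fun _ _ (T f) q _ nT).
    by apply: open_nbhs_nbhs; split=> //; exact: open_neq.
  rewrite nbhsE => -[U [Uop Uq] UT].
  rewrite ladder_openE in Uop; have [m mU] := Uop.1 a S'a Uq.
  by have /negP := UT _ (mU m (leqnn m)); apply; apply/eqP/Tf0 => //=.
(* Half the inverse of a positive bound for the norm of G. *)
pose e : R := (2 * (Num.max N 0 + 1))^-1.
have N0 : 0 <= Num.max N 0 by rewrite le_max lexx orbT.
have e0 : 0 < e by rewrite invr_gt0 mulr_gt0// ltr_wpDl.
(* As a is not in S, seg a is closed in the source space, so functional_tail
   applies to evaluation at q. *)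
have [b /= ba bP] : exists2 b, [set b | (b < a)%O] b &
    forall f : cspace (ladder_space lS) R,
    `|f| <= 1 -> (forall x, seg lS b x -> f x = 0) -> `|T f q| <= e.
  apply: (@functional_tail R (ladder_space lS) _ kappa _ None (seg lS a) (seg lS)
    _ _ _ _ _ _ _ M) => //.
  - by exists (l a 0%N); exact: la.
  - exact: seg_open.
  - exact: seg_closed.
  - exact: seg_open.
  - exact: seg_mono.
  - move=> [[b c]|] [/= ba nN]; last by case: nN.
    have [k bk] := lcof b ba; exists (l a k.+1); first exact: la.
    exact: le_lt_trans (lt_l k).
have hGa : (hG b < a)%O by have := ha b ba; rewrite gt_max => /andP[].
(* The function u is 1 at q and 0 on seg (hG b), so that G u vanishes on seg b,
   and T (G u) q = 1 is too large. *)
pose u : cspace (ladder_space lS') R :=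
  mkcts (indic_continuous (R := R) (@nb_tail_open _ _ _ _ lS' _ _ hGa)
    (@nb_tail_closed _ _ _ _ lS' _ _ hGa)).
have uE x : u x = (x \in nb_tail lS' a (hG b))%:R by [].
have u1 : `|u| <= 1.
  by apply: sup_norm_le => // x; rewrite uE; case: (_ \in _); rewrite ?normr1 ?normr0.
have uq : u q = 1.
  rewrite uE mem_set//; split; first exact: ladder_nbxx.
  by apply/negP; rewrite -leNgt ltW.
have u0 x : seg lS' (hG b) x -> u x = 0.
  by move=> xs; rewrite uE memNset// => -[].
have Gu0 x : seg lS b x -> G u x = 0 by exact: hGP.
pose c := Num.max N 0 + 1.
have c0 : 0 < c by rewrite ltr_wpDl.
have Gu1 : `|G u| <= c.
  apply: le_trans (GN u) _; apply: (@le_trans _ _ (Num.max N 0)); last by rewrite lerDl.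
  apply: (@le_trans _ _ (Num.max N 0 * `|u|)).
    by rewrite ler_wpM2r// le_max lexx.
  by rewrite ler_piMr.
have := bP (c^-1 *: G u) _ _.
rewrite linearZ GK.
have -> : (c^-1 *: u) q = c^-1 * u q by [].
rewrite uq mulr1 normrZ gtr0_norm ?invr_gt0// ler_pdivrMl// mulr1 => /(_ Gu1).
rewrite /e invfM -/c => H.
have : c^-1 <= 2^-1 * c^-1.
  by apply: H => x /Gu0 Gx; rewrite -[RHS](mulr0 c^-1) -Gx.
by rewrite ler_pMl ?invr_gt0//; lra.
Qed.

End Operators.

Theorem theorem1p1 (R : realType) (d : Order.disp_t) (kappa : orderType d)
    (kappa_card : is_cardinal kappa)
    (kappa_unc : ~ countable [set: kappa])
    (kappa_reg : is_regular kappa) :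
  exists K : set kappa -> compactSpaceType,
    (forall A : set kappa, has_weight (K A) kappa) /\
    (forall A B : set kappa, A <> B ->
      ~ isomorphic (cspace (K A) R) (cspace (K B) R)).
Proof.
pose E := [set a : kappa | exists l, ladder a l].
have statE : stationary E by exact: stationary_ladder.
have /choice[l lE] : forall a, exists l, E a -> ladder a l.
  move=> a; have [x0 _] := kappa_point kappa_unc.
  by have [[l la]|nE] := pselect (E a); [exists l|exists (fun=> x0)].
have [n [e [e_inj eP]]] := stationary_split kappa_card kappa_unc kappa_reg statE lE.
(* The sets S A and S B differ by at least one stationary fibre of the rung n. *)
pose S (A : set kappa) := [set a | E a /\ exists2 c, A c & l a n = e c].
have lS A a : S A a -> ladder a (l a) by case=> /lE.
exists (fun A => ladder_space (lS A)); split=> [A|A B AB]; first exact: ladder_weight.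
move=> [f [g [fK gK fb gb]]].
have glin : linear g.
  move=> r u v; apply: (can_inj fK); rewrite linearP !gK.
  by [].
pose g' : {linear _ -> _} := HB.pack g (GRing.isLinear.Build R _ _ _ g glin).
have diff (C D : set kappa) c : C c -> ~ D c -> stationary (S C `\` S D).
  move=> Cc nDc h; have [a [Ea lac] ah] := eP c h; exists a => //; split.
    by split=> //; exists c.
  by move=> [_ [c' Dc']]; rewrite lac => /e_inj cc'; apply: nDc; rewrite cc'.
have [[c Ac nBc]|nAB] := pselect (exists2 c, A c & ~ B c).
  exact: (@stationary_diff_not_embed _ _ R _ _ _ _ _ _ _ _ g' f (diff _ _ _ Ac nBc)).
have [[c Bc nAc]|nBA] := pselect (exists2 c, B c & ~ A c).
  exact: (@stationary_diff_not_embed _ _ R _ _ _ _ _ _ _ _ f g' (diff _ _ _ Bc nAc)).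
apply: AB; apply/seteqP; split=> c cP; apply: contrapT => nc.
  by apply: nAB; exists c.
by apply: nBA; exists c.
Qed.
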